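(* Let $\mathcal{P}=\langle X\mid R\rangle$ be a finitely generated group presentation with $R$ closed under inversion, let $\Delta$ and $\Omega_g$ be the Dehn function and the group work of $\mathcal{P}$, and let $\mathsf{DL}$ and $\Omega$ be the derivational length and the derivational work of the monoid presentation corresponding to $\mathcal{P}$. Let $n$ be a natural number. Then: 1. $\Omega_g(n)\le\Omega(n,0)\le 4\,\Omega_g(n)^3+\Omega_g(n)^2+(4n+1)\,\Omega_g(n)-n$. 2. If the lengths of the elements of $R$ are bounded above by a natural number $c$ (in particular if $R$ is finite and $c$ is the maximal length of its elements), then $$\Delta(n)\le\mathsf{DL}(n,0)\le 2c\,\Delta(n)^2+\left(2n+\frac{c}{2}+1\right)\Delta(n)-\frac{n}{2}$$ and $$\Omega_g(n)\le\Omega(n,0)\le 4c\,\Omega_g(n)^2+(4n+c+1)\,\Omega_g(n)-n.$$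
   Context: $\mathcal{F}(X)$ is the free group on $X$, identified with the set of reduced words on $X\cup X^{-1}$; $\rho$ sends a word on $X\cup X^{-1}$ to its reduced form. A group presentation $\langle X\mid R\rangle$ has $R\subset\mathcal{F}(X)$ (defining relators); its relators are the elements of the normal closure $\mathcal{N}$ of $R$ in $\mathcal{F}(X)$. For a relator $w$: $\mathsf{area}(w)$ is the least $k$ such that $w=\rho(a_1r_1a_1^{-1}\cdots a_kr_ka_k^{-1})$ for some $a_i\in\mathcal{F}(X)$, $r_i\in R$; $\mathsf{gwork}(w)$ is the least value of $|r_1|+\cdots+|r_k|$ over all such expressions (with any $k$). $\Delta(n)=\max\{\mathsf{area}(w): w\text{ a relator},|w|\le n\}$ and $\Omega_g(n)=\max\{\mathsf{gwork}(w): w\text{ a relator},|w|\le n\}$. The monoid presentation corresponding to $\mathcal{P}$ has generators $X\cup X^{-1}$ and defining relations the symmetrization (closure under swapping pairs) of $\{(u,v^{-1})\in\mathcal{F}(X)^2: uv\in R\}\cup\{(xx^{-1},1): x\in X\cup X^{-1}\}$, where $uv$ is the concatenation of the reduced words $u,v$ and $1$ is the empty word. For a monoid presentation $\langle Y\mid S\rangle$ with $S$ symmetric, the relations are the pairs in the congruence on the free monoid on $Y$ generated by $S$. A one step derivation by means of $(a,b)\in S$ is a pair $(xay,xby)$ with $x,y$ words on $Y$, and it has work $|a|+|b|$; a $k$ steps derivation from $u$ to $v$ is a sequence $(u_0=u,\dots,u_k=v)$ of words with consecutive pairs one step derivations, its work being the sum of the works of its steps. For a relation $(u_1,u_2)$,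 $\mathsf{dl}(u_1,u_2)$ is the minimal number of steps, and $\mathsf{work}(u_1,u_2)$ the minimal work, of a derivation from $u_1$ to $u_2$. $\mathsf{DL}(n_1,n_2)$ and $\Omega(n_1,n_2)$ are the maxima of $\mathsf{dl}(u_1,u_2)$ and $\mathsf{work}(u_1,u_2)$ respectively over relations with $|u_1|\le n_1$, $|u_2|\le n_2$.
   Formalization: The upper bounds are stated only when n = 0 or some relator w ≠ 1 has |w| ≤ n; otherwise Δ(n) = Ω_g(n) = 0 and the right-hand sides are −n or −n/2 < 0 (e.g. R empty, n = 1), so the printed bounds fail. The lower bounds are unconditional. *)

(* Defs.v *)
From HB Require Import structures.
From mathcomp Require Import all_boot all_order all_algebra.
From mathcomp Require Import boolp classical_sets.

Set Implicit Arguments.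
Unset Strict Implicit.
Unset Printing Implicit Defensive.

(* [(x, false)] stands for x and [(x, true)] for x^-1. *)
Definition letter (X : Type) : Type := (X * bool)%type.
HB.instance Definition _ (X : finType) := Finite.on (letter X).

Section Words.
Variable X : finType.
Implicit Types (x y : letter X) (u v w : seq (letter X)).

Definition linv x : letter X := (x.1, ~~ x.2).

Definition winv w := rev (map linv w).

Definition reduced w := sorted (fun x y => y != linv x) w.

Definition push x w :=
  if w is y :: w' then if y == linv x then w' else x :: w else [:: x].

Definition rho w := foldr push [::] w.

Lemma linvK : involutive linv.
Proof. by case=> x b; rewrite /linv /= negbK. Qed.

Lemma winvK : involutive winv.
Proof. by move=> w; rewrite /winv map_rev revK mapK //; exact: linvK. Qed.

Lemma winv_cat u v : winv (u ++ v) = winv v ++ winv u.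
Proof. by rewrite /winv map_cat rev_cat. Qed.

Lemma push_reduced x w : reduced w -> reduced (push x w).
Proof.
case: w => // y w; rewrite /push; case: ifP => [_|/negbT yx] rw.
  exact: path_sorted rw.
by rewrite /reduced /= yx.
Qed.

Lemma foldr_push_reduced u w : reduced w -> reduced (foldr push w u).
Proof. by move=> rw; elim: u => //= x u; exact: push_reduced. Qed.

Lemma rho_reduced w : reduced (rho w).
Proof. exact: foldr_push_reduced. Qed.

Lemma rho_id w : reduced w -> rho w = w.
Proof.
elim: w => //= x w IH rxw; have rw := path_sorted rxw.
rewrite IH // /push; case: w rxw {IH rw} => //= y w /andP[/negbTE -> _] //.
Qed.

Lemma pushK x w : reduced w -> push x (push (linv x) w) = w.
Proof.
case: w => [|y w] rw; first by rewrite /= eqxx.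
rewrite {2}/push linvK; case: eqP => [yx|_]; last by rewrite /= eqxx.
rewrite yx in rw *; case: w rw => //= z w /andP[/negbTE -> _] //.
Qed.

Lemma foldr_push_rho u w : reduced w -> foldr push w (rho u) = foldr push w u.
Proof.
move=> rw; elim: u => //= x u <-.
case: (rho u) => //= y t; case: eqP => [->|//].
by rewrite pushK //; exact: foldr_push_reduced.
Qed.

Lemma rho_cat u v : rho (u ++ v) = foldr push (rho v) u.
Proof. exact: foldr_cat. Qed.

Lemma rho_catl u v : rho (rho u ++ v) = rho (u ++ v).
Proof. by rewrite !rho_cat foldr_push_rho ?rho_reduced. Qed.

Lemma rho_catr u v : rho (u ++ rho v) = rho (u ++ v).
Proof. by rewrite !rho_cat (rho_id (rho_reduced v)). Qed.

Lemma rho_winvl w : rho (winv w ++ w) = [::].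
Proof.
rewrite rho_cat /rho; elim: w => //= x w IH.
rewrite /winv /= rev_cons -cats1 foldr_cat /=.
have {2}-> : x = linv (linv x) by rewrite linvK.
by rewrite pushK ?rho_reduced // -[RHS]IH.
Qed.

Lemma winv_reduced w : reduced w -> reduced (winv w).
Proof.
rewrite /reduced /winv rev_sorted sorted_map; apply: sub_sorted => x y.
by apply: contraNneq => /(can_inj linvK) ->; rewrite linvK.
Qed.

End Words.

Record freeGroup (X : finType) : Type := FreeGroup {
  fgval :> seq (letter X);
  fgvalP : reduced fgval }.
HB.instance Definition _ (X : finType) := [isSub for @fgval X].
HB.instance Definition _ (X : finType) := [Choice of freeGroup X by <:].

Section FreeGroup.
Variable X : finType.
Implicit Types f g h : freeGroup X.

Definition fg1 : freeGroup X := @FreeGroup X [::] isT.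
Definition fgmul f g : freeGroup X := FreeGroup (rho_reduced (f ++ g)).
Definition fginv f : freeGroup X := FreeGroup (winv_reduced (fgvalP f)).

Fact fgmulA : associative fgmul.
Proof. by move=> f g h; apply: val_inj; rewrite /= rho_catl rho_catr catA. Qed.
Fact fgmul1g : left_id fg1 fgmul.
Proof. by move=> f; apply: val_inj; rewrite /= rho_id // fgvalP. Qed.
Fact fgmulg1 : right_id fg1 fgmul.
Proof. by move=> f; apply: val_inj; rewrite /= cats0 rho_id // fgvalP. Qed.
Fact fgmulVg : left_inverse fg1 fginv fgmul.
Proof. by move=> f; apply: val_inj; rewrite /= rho_winvl. Qed.
Fact fgmulgV : right_inverse fg1 fginv fgmul.
Proof. by move=> f; apply: val_inj; rewrite /= -{1}(winvK f) rho_winvl. Qed.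

HB.instance Definition _ :=
  isGroup.Build (freeGroup X) fgmulA fgmul1g fgmulg1 fgmulVg fgmulgV.

Definition ball n : seq (freeGroup X) :=
  pmap insub [seq val u | u : n.-bseq (letter X)].

Lemma mem_ball n f : (f \in ball n) = (size f <= n).
Proof.
rewrite mem_pmap_sub; apply/mapP/idP => [[u _ ->]|le_n].
  exact: size_bseq.
by exists (Bseq le_n); rewrite ?mem_enum.
Qed.

End FreeGroup.

(* The minimum of a nonempty set of naturals; 0 on the empty set. *)
Definition least (A : set nat) : nat :=
  xget 0 [set k | A k /\ forall j, A j -> k <= j].

Lemma leastP (A : set nat) k :
  A k -> A (least A) /\ forall j, A j -> least A <= j.
Proof.
move=> Ak; rewrite /least; case: xgetP => [m _ []//|noleast].
have exA : exists j, `[< A j >] by exists k; apply/asboolP.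
case: (ex_minnP exA) => m /asboolP Am minm.
by case: (noleast m); split=> // j Aj; apply/minm/asboolP.
Qed.

Section GroupPresentation.
Variables (X : finType) (R : set (freeGroup X)).
Local Open Scope group_scope.

Inductive normal_closure : freeGroup X -> Prop :=
| nc_gen r : R r -> normal_closure r
| nc_one : normal_closure 1
| nc_mul f g : normal_closure f -> normal_closure g -> normal_closure (f * g)
| nc_inv f : normal_closure f -> normal_closure f^-1
| nc_conj a f : normal_closure f -> normal_closure (a * f * a^-1).

Definition relator (w : freeGroup X) : Prop := normal_closure w.

(* [s] lists the pairs (a_i, r_i). *)
Definition expression (w : freeGroup X) (s : seq (freeGroup X * freeGroup X)) :=
  (forall p, p \in s -> R p.2) /\
  fgval w = rho (flatten [seq fgval p.1 ++ fgval p.2 ++ winv p.1 | p <- s]).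

Definition area (w : freeGroup X) : nat :=
  least [set k | exists2 s, expression w s & size s = k].

Definition gwork (w : freeGroup X) : nat :=
  least [set k | exists2 s, expression w s & (\sum_(p <- s) size p.2)%N = k].

Definition Delta (n : nat) : nat :=
  \max_(w <- ball X n | `[< relator w >]) area w.

Definition Omega_g (n : nat) : nat :=
  \max_(w <- ball X n | `[< relator w >]) gwork w.

End GroupPresentation.

Section MonoidPresentation.
Variables (Y : finType) (S : seq Y -> seq Y -> Prop).
Implicit Types a b u v w x y : seq Y.

Inductive congruence_closure : seq Y -> seq Y -> Prop :=
| cc_gen a b : S a b -> congruence_closure a b
| cc_refl u : congruence_closure u u
| cc_sym u v : congruence_closure u v -> congruence_closure v u
| cc_trans u v w :
    congruence_closure u v -> congruence_closure v w -> congruence_closure u w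
| cc_cat x y u v :
    congruence_closure u v -> congruence_closure (x ++ u ++ y) (x ++ v ++ y).

(* [derivation u v k m]: a derivation from u to v with k steps and work m. *)
Inductive derivation : seq Y -> seq Y -> nat -> nat -> Prop :=
| derivation_nil u : derivation u u 0 0
| derivation_cons x a b y v k m :
    S a b -> derivation (x ++ b ++ y) v k m ->
    derivation (x ++ a ++ y) v k.+1 (size a + size b + m).

Definition dl u v : nat := least [set k | exists m, derivation u v k m].

Definition work u v : nat := least [set m | exists k, derivation u v k m].

Definition DL (n1 n2 : nat) : nat :=
  \max_(u : n1.-bseq Y * n2.-bseq Y | `[< congruence_closure u.1 u.2 >])
    dl u.1 u.2.

Definition Omega (n1 n2 : nat) : nat :=
  \max_(u : n1.-bseq Y * n2.-bseq Y | `[< congruence_closure u.1 u.2 >])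
    work u.1 u.2.

End MonoidPresentation.

Section CorrespondingPresentation.
Variables (X : finType) (R : set (freeGroup X)).

(* In [mrel_split] the plain concatenation of u and v is the word r. *)
Inductive mrel_base : seq (letter X) -> seq (letter X) -> Prop :=
| mrel_split (u v r : freeGroup X) :
    R r -> fgval r = fgval u ++ fgval v -> mrel_base u (v^-1)%g
| mrel_cancel (x : letter X) : mrel_base [:: x; linv x] [::].

Definition mrel (a b : seq (letter X)) : Prop := mrel_base a b \/ mrel_base b a.

End CorrespondingPresentation.

(* Main.v *)
Require Import Defs.
From HB Require Import structures.
From mathcomp Require Import all_boot all_order all_algebra.
From mathcomp Require Import boolp classical_sets.
From mathcomp Require Import zify lra.

Set Implicit Arguments.
Unset Strict Implicit.
Unset Printing Implicit Defensive.
Import Order.TTheory GRing.Theory Num.Theory.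

(** Idea of the proof. Read a derivation of [w] to the empty word in the free
    group: a defining relation of the first kind multiplies by a conjugate of one
    relator, and a cancellation changes nothing. This gives the lower bounds.

    For the upper bounds, a word [w] that is freely equal to a product of
    conjugates of relators of total length [g] bounds a planar disc diagram, which
    can be peeled from the first letter [x] of [w]: either [x] is a bridge, matched
    with a later letter [x^-1], or [x] lies on a face, labelled by a rotated
    relator [x s], and removing that face replaces [x] by [s^-1]. Peeling
    translates into a derivation with at most [(|w| + 3 g) / 2] steps and work at
    most [|w| + 4 g]. These linear bounds imply the polynomial ones. *)

(** * Comparing two factorizations of a word *)

Lemma cat_eq_cat_cons (T : Type) (a b u v : seq T) z :
  a ++ b = u ++ z :: v ->
  (exists d, a = u ++ z :: d /\ v = d ++ b) \/
  (exists d, u = a ++ d /\ b = d ++ z :: v).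
Proof.
elim: a u => [|x a IH] [|y u] /=.
- by move=> ->; right; exists [::].
- by move=> ->; right; exists (y :: u).
- by case=> <- <-; left; exists a.
- case=> <- /IH[[d [-> ->]]|[d [-> ->]]]; first by left; exists d.
  by right; exists d.
Qed.

Lemma cat_eq_cat (T : Type) (a b u v : seq T) :
  a ++ b = u ++ v ->
  (exists d, a = u ++ d /\ v = d ++ b) \/ (exists d, u = a ++ d /\ b = d ++ v).
Proof.
case: v => [|z v]; first by rewrite cats0 => <-; right; exists b; rewrite cats0.
move=> E; have [[d [-> ->]]|[d [-> ->]]] := cat_eq_cat_cons E.
  by left; exists (z :: d).
by right; exists d.
Qed.

Lemma least_le (A : set nat) k : A k -> least A <= k.
Proof. by move=> Ak; have [_] := leastP Ak; apply. Qed.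

(** * Derivations in a symmetric monoid presentation *)

Section Derivations.
Variables (Y : finType) (S : seq Y -> seq Y -> Prop).
Implicit Types a b u v w x y : seq Y.

Lemma derivation_trans u v w k m k' m' :
  derivation S u v k m -> derivation S v w k' m' ->
  derivation S u w (k + k') (m + m').
Proof.
move=> D; elim: D => {u v k m} // x a b y v k m Sab _ IH /IH D.
by rewrite -addnA addSn; apply: derivation_cons D.
Qed.

Lemma derivation_cat x y u v k m :
  derivation S u v k m -> derivation S (x ++ u ++ y) (x ++ v ++ y) k m.
Proof.
move=> D; elim: D => {u v k m} [u|x' a b y' v k m Sab _ IH].
  exact: derivation_nil.
have -> : x ++ (x' ++ a ++ y') ++ y = (x ++ x') ++ a ++ (y' ++ y).
  by rewrite !catA.
by apply: derivation_cons Sab _; move: IH; rewrite !catA.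
Qed.

Lemma derivation_step a b : S a b -> derivation S a b 1 (size a + size b).
Proof.
move=> Sab.
have := derivation_cons (x := [::]) (y := [::]) Sab (derivation_nil S _).
by rewrite /= !cats0 addn0.
Qed.

Lemma derivation_congruence u v k m :
  derivation S u v k m -> congruence_closure S u v.
Proof.
move=> D; elim: D => {u v k m} [u|x a b y v k m Sab _ IH]; first exact: cc_refl.
by apply: cc_trans IH; apply: cc_cat; apply: cc_gen.
Qed.

Lemma derivation_sym u v k m : (forall a b, S a b -> S b a) ->
  derivation S u v k m -> derivation S v u k m.
Proof.
move=> Ssym D; elim: D => {u v k m} [u|x a b y v k m Sab _ IH].
  exact: derivation_nil.
have := derivation_trans IH (derivation_cat x y (derivation_step (Ssym _ _ Sab))).
by rewrite addn1 addnC (addnC (size b)).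
Qed.

(** Symmetry lets derivations be reversed. Hence the minima in [dl] and [work] are attained on every
    relation and are not the default 0. *)
Lemma congruence_derivation u v : (forall a b, S a b -> S b a) ->
  congruence_closure S u v -> exists k m, derivation S u v k m.
Proof.
move=> Ssym; elim=> {u v} [a b /derivation_step D|u|u v _ [k [m D]]||].
- by exists 1, (size a + size b).
- by exists 0, 0; apply: derivation_nil.
- by exists k, m; apply: derivation_sym.
- move=> u v w _ [k [m D]] _ [k' [m' D']].
  by exists (k + k'), (m + m'); apply: derivation_trans D'.
- by move=> x y u v _ [k [m D]]; exists k, m; apply: derivation_cat.
Qed.

End Derivations.

(** * Disc diagrams encoded by their boundary words *)

Section Discs.
Variables (X : finType) (R : set (freeGroup X)).
Implicit Types (x y z : letter X) (a b c d s t u v w : seq (letter X)).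

Lemma winv_cons x w : winv (x :: w) = winv w ++ [:: linv x].
Proof. by rewrite /winv /= rev_cons cats1. Qed.

Lemma size_winv w : size (winv w) = size w.
Proof. by rewrite /winv size_rev size_map. Qed.

(** Boundary label of a face read from any vertex; it may fail to be reduced, so it is a plain
    word. *)
Definition rotated_relator w :=
  exists u v (r : freeGroup X), [/\ R r, fgval r = u ++ v & w = v ++ u].

Lemma rotated_relator_of (r : freeGroup X) : R r -> rotated_relator r.
Proof. by move=> Rr; exists [::], r, r; rewrite cats0. Qed.

Lemma rotated_relatorC u v : rotated_relator (u ++ v) -> rotated_relator (v ++ u).
Proof.
move=> [p [q [r [Rr rE /cat_eq_cat[[d [uE pE]]|[d [qE vE]]]]]]].
  by exists d, (v ++ q), r; split=> //; rewrite ?rE ?pE ?uE ?catA.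
by exists (p ++ u), d, r; split=> //; rewrite ?rE ?qE ?vE ?catA.
Qed.

(* [disc w g]: the word w bounds a disc diagram whose faces have total perimeter
   at most g, described by peeling it from the first letter of w. The slack in
   [disc_nil] lets whole faces be thrown away, as happens when a cancellation
   closes up a sphere. *)
Inductive disc : seq (letter X) -> nat -> Prop :=
| disc_nil g : disc [::] g
| disc_bridge x u v g h :
    disc u g -> disc v h -> disc (x :: u ++ linv x :: v) (g + h)
| disc_face x s w g :
    rotated_relator (x :: s) -> disc (winv s ++ w) g ->
    disc (x :: w) ((size s).+1 + g).

Lemma disc_le w g h : disc w g -> g <= h -> disc w h.
Proof.
move=> D; elim: D h => {w g} [g|x u v g1 g2 Du _ _ IHv|x s w g Rxs _ IH] h le_h.
- exact: disc_nil.
- have -> : h = g1 + (h - g1) by lia.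
  by apply: disc_bridge => //; apply: IHv; lia.
- have -> : h = (size s).+1 + (h - (size s).+1) by lia.
  by apply: disc_face => //; apply: IH; lia.
Qed.

Lemma disc_cat u v g h : disc u g -> disc v h -> disc (u ++ v) (g + h).
Proof.
move=> Du Dv; elim: Du => {u g} [g|x u1 u2 g1 g2 D1 _ _ IH|x s w g Rxs _ IH].
- by apply: disc_le Dv _; lia.
- by rewrite /= -catA -addnA; apply: disc_bridge.
- by rewrite /= -addnA; apply: disc_face => //; rewrite catA.
Qed.

(** A second disc is glued at a boundary vertex. If the first letter is a bridge, its mate tells
    which of the two sides receives [c]. *)
Lemma disc_insert a b c g h :
  disc (a ++ b) g -> disc c h -> disc (a ++ c ++ b) (g + h).
Proof.
move E: (a ++ b) => w D Dc.
elim: D a b E => {w g} [g|x u v g1 g2 Du IHu Dv IHv|x s w g Rxs Dw IH] [|y a] b //=.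
- by move=> ->; rewrite cats0; apply: disc_le Dc _; lia.
- move=> ->; rewrite addnC; apply: disc_cat => //; exact: disc_bridge.
- case=> -> E; have [[d [-> vE]]|[d [uE ->]]] := cat_eq_cat_cons E.
    rewrite -catA /= -addnA; apply: disc_bridge => //; exact: IHv.
  have -> : a ++ c ++ d ++ linv x :: v = (a ++ c ++ d) ++ linv x :: v.
    by rewrite -!catA.
  by rewrite addnAC; apply: disc_bridge => //; apply: IHu.
- move=> ->; rewrite addnC; apply: disc_cat => //; exact: disc_face.
- case=> -> wE; rewrite -addnA; apply: disc_face => //.
  by rewrite catA; apply: IH; rewrite -catA wE.
Qed.

Lemma disc_conj t w g : disc w g -> disc (winv t ++ w ++ t) g.
Proof.
elim/last_ind: t w => [|t x IH] w Dw; first by rewrite cats0.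
have -> : winv (rcons t x) ++ w ++ rcons t x =
    linv x :: (winv t ++ w ++ t) ++ [:: linv (linv x)].
  by rewrite -cats1 winv_cat linvK /= -!catA.
by rewrite -[g]addn0; apply: disc_bridge; [exact: IH | exact: disc_nil].
Qed.

Lemma disc_winv t : disc (winv t ++ t) 0.
Proof. by apply: (@disc_conj t [::]); exact: disc_nil. Qed.

(* Rotation across a face needs a face replacement, and a face replacement needs
   rotation. [size w + g] decreases when a face [x s] is peeled: the boundary
   grows by [size s - 1] while g drops by [size s + 1]. *)
Lemma disc_rot_face m :
  (forall x w g, size w + g < m -> disc (x :: w) g -> disc (w ++ [:: x]) g) /\
  (forall a s b t g, size (a ++ winv s ++ b) + g <= m -> rotated_relator (t ++ s) ->
     disc (a ++ winv s ++ b) g -> disc (a ++ t ++ b) (size (t ++ s) + g)).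
Proof.
elim/ltn_ind: m => m IHm.
have rot1_lt x w g : size w + g < m.-1 -> disc (x :: w) g -> disc (w ++ [:: x]) g.
  by move=> lt_m; apply: (IHm m.-1 _).1; lia.
have rot_of k : (forall x w g, size w + g < k -> disc (x :: w) g ->
      disc (w ++ [:: x]) g) -> forall a b g, size (a ++ b) + g <= k ->
      disc (a ++ b) g -> disc (b ++ a) g.
  move=> rot1; elim=> [|x a IH] b g; first by rewrite cats0.
  rewrite /= => le_k D; rewrite -cat1s catA; apply: IH.
    by move: le_k; rewrite !size_cat /=; lia.
  by rewrite catA; apply: rot1 D; lia.
have rot1_m x w g : size w + g < m -> disc (x :: w) g -> disc (w ++ [:: x]) g.
  move=> lt_m D; move E: (x :: w) D => w' D.
  case: D E lt_m => // [y u v g1 g2 Du Dv [-> ->]|y s w1 g1 Rys Dw1 [-> ->]] lt_m.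
    rewrite -catA; apply: disc_cat => //.
    rewrite -{2}(linvK y) /= -[g2]addn0; apply: disc_bridge => //.
    exact: disc_nil.
  (* The peeled disc is rotated first, and then the face is glued back with [y] now at the end. *)
  have Dr : disc (w1 ++ winv s ++ [::]) g1.
    rewrite cats0; apply: (rot_of m.-1) Dw1 => //.
    by rewrite size_cat size_winv; lia.
  apply: ((IHm m.-1 _).2 w1 s [::] [:: y] g1) => //; first by lia.
  by rewrite !size_cat size_winv /=; lia.
have rot_m := rot_of m rot1_m.
have face_cons y a s b t g : size (y :: a ++ winv s ++ b) + g <= m ->
    rotated_relator (t ++ s) -> disc (y :: a ++ winv s ++ b) g ->
    disc (y :: a ++ t ++ b) (size (t ++ s) + g).
  move=> le_m Rts D; have m_gt0 : 0 < m by exact: leq_trans le_m.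
  move E: (y :: _) D => w' D.
  case: D E le_m => // [x u v g1 g2 Du Dv [-> E]|x s0 w g0 Rs0 D0 [-> E]] le_m;
    last first.
    rewrite addnCA; apply: disc_face => //; rewrite catA.
    apply: (IHm m.-1 _).2 => //; first by lia.
      by move: le_m; rewrite -catA size_cat size_winv E /=; lia.
    by rewrite -catA E.
  (* Three positions for the mate of the bridge [x]: in [a], on the arc [winv s], or in [b]. In the
     outer cases the arc lies on one side of the bridge. *)
  have [[d [aE vE]]|[d [uE E2]]] := cat_eq_cat_cons E.
    rewrite aE -catA /= addnCA; apply: disc_bridge => //.
    apply: (IHm m.-1 _).2 => //; first by lia.
      by rewrite -vE; move: le_m; rewrite /= E !size_cat /=; lia.
    by rewrite -vE.
  have [[d2 [sE vE]]|[d2 [dE bE]]] := cat_eq_cat_cons E2; last first.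
    have -> : a ++ t ++ b = (a ++ t ++ d2) ++ linv x :: v by rewrite bE !catA.
    rewrite addnA; apply: disc_bridge => //.
    apply: (IHm m.-1 _).2 => //; first by lia.
      by rewrite -dE -uE; move: le_m; rewrite /= E !size_cat /=; lia.
    by rewrite -dE -uE.
  (* The mate of x lies on the replaced arc, so x ends up on the new face. *)
  have sE' : s = winv d2 ++ x :: winv d.
    by rewrite -[s]winvK sE winv_cat winv_cons linvK -catA.
  have Rx : rotated_relator (x :: (winv d ++ t ++ winv d2)).
    move: Rts; rewrite sE' catA => /rotated_relatorC.
    by rewrite /= -?catA.
  have -> : size (t ++ s) + (g1 + g2) =
      (size (winv d ++ t ++ winv d2)).+1 + (g2 + g1).
    by rewrite sE' !size_cat /= !size_winv; lia.
  apply: disc_face => //.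
  (* The side [u = a d] is rotated, conjugated by [t], and inserted into the other side
     [v = d2 b]. *)
  have Dda : disc (d ++ a) g1.
    apply: rot_m; rewrite -uE //.
    by move: le_m; rewrite /= E !size_cat /=; lia.
  rewrite vE in Dv; have := disc_insert Dv (disc_conj t Dda).
  by rewrite !winv_cat !winvK -!catA.
split=> // -[|y a] s b t g le_m Rts D; last exact: face_cons.
(* The first letter of [t] is peeled off the new face; the remaining letters only form a spike. *)
case: t Rts => [|x t] Rts; last first.
  have -> : size ((x :: t) ++ s) + g = (size (t ++ s)).+1 + g by [].
  apply: (@disc_face x (t ++ s) (t ++ b)) => //.
  have := disc_insert (D : disc (winv s ++ b) g) (disc_winv t).
  by rewrite addn0 winv_cat -!catA.
(* With [a] and [t] empty, either the sphere closes up and is discarded by the slack of [disc_nil],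
   or a rotation puts [b] in front of the arc. *)
case: b le_m D => [|y b] le_m D; first exact: disc_nil.
rewrite -[[::] ++ _ ++ _]cats0 -catA.
have := @face_cons y b s [::] [::] g; rewrite /= !cats0; apply => //.
  by move: le_m; rewrite /= !size_cat /=; lia.
by apply: (rot_m (winv s) (y :: b)).
Qed.

(** Although [disc] peels from the first letter, the base point is immaterial. *)
Lemma disc_rot a b g : disc (a ++ b) g -> disc (b ++ a) g.
Proof.
elim: a b => [|x a IH] b; first by rewrite cats0.
move=> D; rewrite -cat1s catA; apply: IH; rewrite catA.
exact: (disc_rot_face (size (a ++ b) + g).+1).1.
Qed.

(** Gluing a face [t s] along the boundary arc [winv s] exposes [t]. *)
Lemma disc_face_cat a s b t g :
  rotated_relator (t ++ s) -> disc (a ++ winv s ++ b) g ->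
  disc (a ++ t ++ b) (size (t ++ s) + g).
Proof. exact: (disc_rot_face (size (a ++ winv s ++ b) + g)).2. Qed.

(** Two adjacent inverse boundary edges are folded together, by induction on the peeling. *)
Lemma disc_cancel a x b g : disc (a ++ x :: linv x :: b) g -> disc (a ++ b) g.
Proof.
move E: (a ++ _) => w D.
elim: D a b E => {w g} [g|y u v g1 g2 Du IHu Dv IHv|y s w g Rys Dw IH] [|z a] b //=.
- case=> -> /esym; case: u Du {IHu} => [|u0 u] Du /= [].
    by move=> <-; apply: disc_le Dv _; lia.
  move=> u0E <-; rewrite u0E -cat1s in Du.
  have -> : u ++ linv y :: v = (u ++ [:: linv y]) ++ v by rewrite -catA.
  by apply: disc_cat => //; apply: disc_rot.
- case=> -> E; have [[d [-> vE]]|[d [uE]]] := cat_eq_cat_cons E.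
    by rewrite -catA /=; apply: disc_bridge => //; apply: IHv.
  (* The mate of [y] is the first letter of the cancelled pair, the second, or lies beyond the
     pair. *)
  case: d uE => [|d0 [|d1 d]] uE E2.
  + have xE : x = linv y := congr1 (head x) E2.
    have vE : linv x :: b = v := congr1 behead E2.
    rewrite addnC; rewrite cats0 in uE; rewrite -{}uE.
    apply: (disc_insert (a := [:: y])) => //.
    by move: Dv; rewrite -vE xE linvK.
  + have xE : x = d0 := congr1 (head x) E2.
    have /(can_inj (@linvK X)) yE : linv x = linv y := congr1 (nth x ^~ 1) E2.
    have -> : b = v := congr1 (behead \o behead) E2.
    apply: (@disc_cat (y :: a)) => //.
    by rewrite -cat1s; apply: disc_rot; rewrite -yE xE -uE.
  + have xE : x = d0 := congr1 (head x) E2.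
    have yE : linv x = d1 := congr1 (nth x ^~ 1) E2.
    have -> : b = d ++ linv y :: v := congr1 (behead \o behead) E2.
    rewrite catA; apply: disc_bridge => //.
    by apply: IHu; rewrite uE -xE -yE.
(* Folding the edge [y] of the face turns its whole boundary into one arc of the peeled disc,
   replaced by the empty word. *)
- case=> -> wE; have := @disc_face_cat [::] (y :: s) b [::] g Rys.
  by rewrite winv_cons -catA /= wE; apply.
- case=> -> wE; apply: disc_face => //.
  by rewrite catA; apply: IH; rewrite -catA wE.
Qed.

Lemma disc_rho_cat a w g : disc (a ++ w) g <-> disc (a ++ rho w) g.
Proof.
elim: w a => // x w IH a; rewrite -cat1s catA {}IH /= -catA /=.
case: (rho w) => //= y v; case: eqP => // ->; split; first exact: disc_cancel.
move=> D; rewrite -[g]addn0; apply: (disc_insert (c := [:: x; linv x])) => //.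
by rewrite -[0]addn0; apply: (@disc_bridge x [::] [::]); exact: disc_nil.
Qed.

Lemma disc_rho w g : disc w g <-> disc (rho w) g.
Proof. exact: (disc_rho_cat [::]). Qed.

Lemma disc_relator (r : freeGroup X) : R r -> disc r (size r).
Proof.
move=> Rr; have := disc_face_cat (a := [::]) (s := [::]) (b := [::]) (t := r).
rewrite !cats0 /= => /(_ 0); rewrite addn0; apply; last exact: disc_nil.
exact: rotated_relator_of.
Qed.

(** The product of conjugates bounds a bouquet of faces on stems, which free reduction folds. *)
Lemma disc_expression (w : freeGroup X) e :
  expression R w e -> disc w (\sum_(p <- e) size p.2).
Proof.
case=> eR ->; apply (disc_rho _ _).1; elim: e eR => [|p e IH] eR /=.
  by rewrite big_nil; exact: disc_nil.
rewrite big_cons; apply: disc_cat.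
  rewrite -{1}(winvK p.1); apply: disc_conj; apply: disc_relator.
  by apply: eR; rewrite mem_head.
by apply: IH => q eq; apply: eR; rewrite inE eq orbT.
Qed.

(** * From discs to derivations *)

Lemma derivation_winv t w :
  derivation (mrel R) w (winv t ++ t ++ w) (size t) (size t).*2.
Proof.
elim: t w => [|x t IH] w; first exact: derivation_nil.
have := derivation_cat (winv t) (t ++ w)
  (derivation_step (or_intror (mrel_cancel R (linv x)) : mrel R _ _)).
rewrite linvK => /(derivation_trans (IH w)).
by rewrite winv_cons -!catA /= addn1 doubleS add0n addn2.
Qed.

(* If r = p x q, insert p^-1 p in front of x and replace p x by q^-1. *)
Lemma derivation_rotated_relator x s w : rotated_relator (x :: s) ->
  exists k m, [/\ derivation (mrel R) (x :: w) (winv s ++ w) k m,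
    k <= (size s).+1 & m <= 3 * size s + 1].
Proof.
move=> [p [q [r [Rr rE sE]]]].
(* When [q] is empty the rotation is trivial, and [r] is split in front of its first letter
   instead. *)
have {p q rE sE} [p [q [rE ->]]] : exists p q, fgval r = p ++ x :: q /\ s = q ++ p.
  case: q rE sE => [|y q] rE /=; last by case=> -> ->; exists p, q.
  by move=> pE; exists [::], s; rewrite rE -pE !cats0.
have := fgvalP r; rewrite rE -cat1s catA => /cat_sorted2[rpx rq].
have step : mrel R (p ++ [:: x]) (winv q).
  left; apply: (mrel_split (u := FreeGroup rpx) (v := FreeGroup rq) Rr).
  by rewrite rE -cat1s catA.
have := derivation_cat (winv p) w (derivation_step step).
move: (derivation_winv p (x :: w)); rewrite -!catA => /derivation_trans D /D {}D.
exists (size p + 1), ((size p).*2 + (size (p ++ [:: x]) + size (winv q))).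
by rewrite winv_cat -catA; split=> //; rewrite !size_cat ?size_winv /=; lia.
Qed.

(** A bridge costs one step of work 2, paid by its two letters. A face [x s] lengthens the word by
    [size s - 1], and its perimeter [size s + 1] pays for this and for the replacement of [x]. *)
Lemma disc_derivation w g : disc w g ->
  exists k m, [/\ derivation (mrel R) w [::] k m,
    2 * k <= size w + 3 * g & m <= size w + 4 * g].
Proof.
elim=> {w g} [g|x u v g h _ [k [m [Du k_le m_le]]] _ [k' [m' [Dv k'_le m'_le]]]
             |x s w g Rs _ [k [m [Dw k_le m_le]]]].
- by exists 0, 0; split=> //; apply: derivation_nil.
- have := derivation_cat [:: x] (linv x :: v) Du.
  have := derivation_cat [::] v
    (derivation_step (or_introl (mrel_cancel R x) : mrel R _ _)).
  move=> D2 D1; have D := derivation_trans D1 (derivation_trans D2 Dv).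
  by eexists; eexists; split; [exact: D| |]; rewrite /= !size_cat /=; lia.
have [k' [m' [D k'_le m'_le]]] := derivation_rotated_relator w Rs.
exists (k' + k), (m' + m); split; first exact: derivation_trans Dw.
  by move: k_le; rewrite size_cat size_winv /=; lia.
by move: m_le; rewrite size_cat size_winv /=; lia.
Qed.

End Discs.

(** * Products of conjugates of relators *)

Section Expressions.
Variables (X : finType) (R : set (freeGroup X)).
Hypothesis Rinv : forall r, R r -> R r^-1%g.
Implicit Types (u v w : seq (letter X)) (e : seq (freeGroup X * freeGroup X)).
Local Open Scope group_scope.

Definition fgword w : freeGroup X := FreeGroup (rho_reduced w).

Lemma fgwordK (f : freeGroup X) : fgword f = f.
Proof. by apply: val_inj; rewrite /= rho_id // fgvalP. Qed.

Lemma fgword_cat u v : fgword (u ++ v) = fgword u * fgword v.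
Proof. by apply: val_inj; rewrite /= rho_catl rho_catr. Qed.

Lemma fgword_winv w : fgword (winv w) = (fgword w)^-1.
Proof.
apply: (@mulIg _ (fgword w)); rewrite mulVg -fgword_cat.
by apply: val_inj; rewrite /= rho_winvl.
Qed.

Lemma fgword_linv (x : letter X) : fgword [:: x; linv x] = 1.
Proof.
by apply: val_inj; rewrite /= eqxx.
Qed.

(** Evaluating in the group rather than on flattened words makes the group laws available. *)
Definition expression_value e : freeGroup X :=
  \prod_(p <- e) (p.1 * p.2 * p.1^-1).

Lemma expressionE (w : freeGroup X) e :
  expression R w e <-> (forall p, p \in e -> R p.2) /\ w = expression_value e.
Proof.
suff -> : expression_value e =
    fgword (flatten [seq fgval p.1 ++ fgval p.2 ++ winv p.1 | p <- e]).
  by split=> -[eR wE]; split=> //; [apply: val_inj | rewrite wE].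
rewrite /expression_value; elim: e => [|p e IH].
  by rewrite big_nil; apply: val_inj.
by rewrite big_cons IH /= !fgword_cat fgword_winv !fgwordK !mulgA.
Qed.

Lemma expression_relator (w : freeGroup X) e : expression R w e -> relator R w.
Proof.
case/expressionE=> eR ->; rewrite /expression_value.
elim: e eR => [|p e IH] eR; first by rewrite big_nil; exact: nc_one.
rewrite big_cons; apply: nc_mul; first by apply/nc_conj/nc_gen/eR/mem_head.
by apply: IH => q eq; apply: eR; rewrite inE eq orbT.
Qed.

Lemma relator_expression (w : freeGroup X) :
  relator R w -> exists e, expression R w e.
Proof.
suff conv : relator R w -> exists e,
    (forall p, p \in e -> R p.2) /\ w = expression_value e.
  by move=> /conv[e we]; exists e; apply/expressionE.
rewrite /expression_value; elim=> {w} [r Rr||f g _ [e [eR ->]] _ [e' [eR' ->]]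
            |f _ [e [eR ->]]|a f _ [e [eR ->]]].
- exists [:: (1, r)]; rewrite big_seq1 /= mul1g invg1 mulg1; split=> // p.
  by rewrite inE => /eqP ->.
- by exists [::]; rewrite big_nil; split.
- exists (e ++ e'); rewrite big_cat; split=> // p.
  by rewrite mem_cat => /orP[/eR|/eR'].
(* Inverting a product of conjugates reverses it and inverts each relator. *)
- exists (rev [seq (p.1, p.2^-1) | p <- e]); split.
    by move=> p; rewrite mem_rev => /mapP[q /eR Rq ->]; apply: Rinv.
  elim: e {eR} => [|p e IH]; first by rewrite !big_nil invg1.
  rewrite big_cons invgM IH /= rev_cons -cats1 big_cat big_seq1 /=.
  by rewrite !invgM invgK !mulgA.
- exists [seq (a * p.1, p.2) | p <- e]; split.
    by move=> p /mapP[q /eR Rq ->].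
  elim: e {eR} => [|p e IH]; first by rewrite !big_nil mulg1 mulgV.
  by rewrite /= !big_cons -IH /= invgM !mulgA !mulgVK.
Qed.

Lemma mrel_sym u v : mrel R u v -> mrel R v u.
Proof. by case; [right | left]. Qed.

(** A split [r = u v] gives [u = r v^-1], and the length of [r] is exactly the work of the step. The
    reversed step uses [r^-1]. *)
Lemma mrel_fgword u v : mrel R u v -> fgword u = fgword v \/
  exists r, [/\ R r, size r = (size u + size v)%N & fgword u = r * fgword v].
Proof.
have base a b : mrel_base R a b -> fgword a = fgword b \/
    exists r, [/\ R r, size r = (size a + size b)%N & fgword a = r * fgword b].
  case=> [f g r Rr rE|x]; last by left; rewrite fgword_linv; apply: val_inj.
  right; exists r; split=> //; first by rewrite rE size_cat /= size_winv.
  by rewrite !fgwordK -[r]fgwordK rE fgword_cat !fgwordK mulgK.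
case=> /base [E|[r [Rr rs E]]]; first by left.
- by right; exists r.
- by left.
right; exists r^-1; split; first exact: Rinv.
  by rewrite /= size_winv rs addnC.
by rewrite E mulKg.
Qed.

(** A step inside [x a y] contributes its relator conjugated by the prefix [x]; a cancellation
    contributes nothing. *)
Lemma derivation_expression u v k m : derivation (mrel R) u v k m ->
  exists e, [/\ forall p, p \in e -> R p.2, fgword u = expression_value e * fgword v,
    size e <= k & (\sum_(p <- e) size p.2 <= m)%N].
Proof.
rewrite /expression_value.
elim=> {u v k m} [u|x a b y v k m /mrel_fgword Sab _ [e [eR E se we]]].
  by exists [::]; rewrite !big_nil mul1g.
rewrite !fgword_cat in E *; case: Sab => [->|[r [Rr rs ->]]].
  exists e; split=> //; first by rewrite ltnW.
  by apply: leq_trans we _; rewrite leq_addl.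
exists ((fgword x, r) :: e); rewrite !big_cons /=; split=> //.
- by move=> p; rewrite inE => /orP[/eqP ->|/eR].
- by rewrite -[RHS]mulgA -E !mulgA mulgVK.
by rewrite rs leq_add2l.
Qed.

End Expressions.

(** * Comparing group and monoid complexity functions *)

Section Bounds.
Variables (X : finType) (R : set (freeGroup X)).
Hypothesis Rinv : forall r, R r -> R r^-1%g.
Implicit Types (u : seq (letter X)) (w : freeGroup X).

Lemma area_attained w : relator R w ->
  exists2 e, expression R w e & size e = area R w.
Proof.
move=> /(relator_expression Rinv)[e we].
by have [] := @leastP [set k | exists2 e, expression R w e & size e = k] _
  (ex_intro2 _ _ e we erefl).
Qed.

Lemma gwork_attained w : relator R w ->
  exists2 e, expression R w e & \sum_(p <- e) size p.2 = gwork R w.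
Proof.
move=> /(relator_expression Rinv)[e we].
by have [] := @leastP
  [set k | exists2 e, expression R w e & \sum_(p <- e) size p.2 = k] _
  (ex_intro2 _ _ e we erefl).
Qed.

Lemma disc_gwork u : relator R (fgword u) -> disc R u (gwork R (fgword u)).
Proof.
move=> /gwork_attained[e ue <-]; apply (disc_rho R u _).2.
exact: (disc_expression ue).
Qed.

Lemma congruence_relator u :
  congruence_closure (mrel R) u [::] -> relator R (fgword u).
Proof.
move=> /congruence_derivation[|k [m /(derivation_expression Rinv)[e [eR uE _ _]]]].
  exact: mrel_sym.
apply: (@expression_relator _ _ _ e); apply/expressionE; split=> //.
by rewrite uE -[RHS]mulg1; congr (_ * _)%g; apply: val_inj.
Qed.

Lemma relator_congruence w : relator R w -> congruence_closure (mrel R) w [::].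
Proof.
rewrite -{1}[w]fgwordK => /disc_gwork/disc_derivation[k [m [D _ _]]].
exact: derivation_congruence D.
Qed.

Lemma derivation_nil_expression w k m : derivation (mrel R) w [::] k m ->
  exists e, [/\ expression R w e, size e <= k & \sum_(p <- e) size p.2 <= m].
Proof.
move=> /(derivation_expression Rinv)[e [eR wE se we]].
exists e; split=> //; apply/expressionE; split=> //.
by rewrite -[LHS]fgwordK wE -[RHS]mulg1; congr (_ * _)%g; apply: val_inj.
Qed.

Lemma area_le_dl w : relator R w -> area R w <= dl (mrel R) w [::].
Proof.
move=> /relator_congruence/congruence_derivation[|k [m D]]; first exact: mrel_sym.
have [|[m' /derivation_nil_expression[e [we se _]]] _] :=
  @leastP [set k | exists m, derivation (mrel R) w [::] k m] k; first by exists m.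
by apply: leq_trans se; apply: least_le; exists e.
Qed.

Lemma gwork_le_work w : relator R w -> gwork R w <= work (mrel R) w [::].
Proof.
move=> /relator_congruence/congruence_derivation[|k [m D]]; first exact: mrel_sym.
have [|[k' /derivation_nil_expression[e [we _ se]]] _] :=
  @leastP [set m | exists k, derivation (mrel R) w [::] k m] m; first by exists k.
by apply: leq_trans se; apply: least_le; exists e.
Qed.

Lemma Delta_le_DL n : Delta R n <= DL (mrel R) n 0.
Proof.
apply/bigmax_leqP_seq => w; rewrite mem_ball => le_n /asboolP Rw.
apply: leq_trans (area_le_dl Rw) _.
apply: (leq_bigmax_cond (Bseq le_n, [bseq])) => /=; apply/asboolP.
exact: relator_congruence.
Qed.

Lemma Omega_g_le_Omega n : Omega_g R n <= Omega (mrel R) n 0.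
Proof.
apply/bigmax_leqP_seq => w; rewrite mem_ball => le_n /asboolP Rw.
apply: leq_trans (gwork_le_work Rw) _.
apply: (leq_bigmax_cond (Bseq le_n, [bseq])) => /=; apply/asboolP.
exact: relator_congruence.
Qed.

Lemma area_le_Delta n w : relator R w -> size w <= n -> area R w <= Delta R n.
Proof.
by move=> Rw le_n; apply: leq_bigmax_seq; rewrite ?mem_ball //; apply/asboolP.
Qed.

Lemma gwork_le_Omega_g n w :
  relator R w -> size w <= n -> gwork R w <= Omega_g R n.
Proof.
by move=> Rw le_n; apply: leq_bigmax_seq; rewrite ?mem_ball //; apply/asboolP.
Qed.

Lemma size_rho u : size (rho u) <= size u.
Proof.
elim: u => //= x u IH; case: (rho u) IH => //= y v; case: eqP => /= _; lia.
Qed.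

Lemma Omega_le n : Omega (mrel R) n 0 <= n + 4 * Omega_g R n.
Proof.
apply/bigmax_leqP => -[u [[|x v] v0]] //=.
move=> /asboolP/congruence_relator Ru.
have [k [m [D _ m_le]]] := disc_derivation (disc_gwork Ru).
apply: leq_trans (least_le _) _; first by exists k; exact: D.
apply: leq_trans m_le _; apply: leq_add; first exact: size_bseq.
rewrite leq_mul2l /=.
exact: gwork_le_Omega_g Ru (leq_trans (size_rho u) (size_bseq u)).
Qed.

(** An expression of minimal area has factors of length at most [c]. *)
Lemma gwork_le_area c w : (forall r, R r -> size r <= c) ->
  relator R w -> gwork R w <= c * area R w.
Proof.
move=> Rc /area_attained[e we <-].
have le_e : \sum_(p <- e) size p.2 <= c * size e.
  have [eR _] := we; elim: e eR {we} => [|p e IH] eR; first by rewrite big_nil.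
  rewrite big_cons /= mulnS; apply: leq_add; first by apply/Rc/eR/mem_head.
  by apply: IH => q eq; apply: eR; rewrite inE eq orbT.
by apply: leq_trans le_e; apply: least_le; exists e.
Qed.

Lemma DL_le n c : (forall r, R r -> size r <= c) ->
  2 * DL (mrel R) n 0 <= n + 3 * (c * Delta R n).
Proof.
(* Dividing by 2 in the naturals isolates the maximum, which is then bounded termwise. *)
move=> Rc; rewrite mulnC -leq_divRL //.
apply/bigmax_leqP => -[u [[|x v] v0]] //=.
move=> /asboolP/congruence_relator Ru.
have [k [m [D k_le _]]] := disc_derivation (disc_gwork Ru).
apply: leq_trans (least_le _) _; first by exists m; exact: D.
rewrite leq_divRL // mulnC; apply: leq_trans k_le _.
apply: leq_add; first exact: size_bseq.
rewrite leq_mul2l /=; apply: leq_trans (gwork_le_area Rc Ru) _.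
rewrite leq_mul2l (area_le_Delta Ru) ?orbT //.
exact: leq_trans (size_rho u) (size_bseq u).
Qed.

Lemma Omega_g_le_Delta n c : (forall r, R r -> size r <= c) ->
  Omega_g R n <= c * Delta R n.
Proof.
move=> Rc; apply/bigmax_leqP_seq => w; rewrite mem_ball => le_n /asboolP Rw.
apply: leq_trans (gwork_le_area Rc Rw) _.
by rewrite leq_mul2l area_le_Delta ?orbT.
Qed.

(** Zero group work would make every relator in an optimal expression trivial, hence [w = 1]. *)
Lemma Omega_g_gt0 n w : relator R w -> w <> 1%g -> size w <= n -> 0 < Omega_g R n.
Proof.
move=> Rw w1 le_n; apply: leq_trans (gwork_le_Omega_g Rw le_n).
have [e /expressionE[_ wE] <-] := gwork_attained Rw; rewrite lt0n.
apply/eqP => e0; apply: w1; rewrite wE /expression_value.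
elim: e e0 {wE} => [|p e IH].
  by rewrite !big_nil.
rewrite !big_cons => /eqP; rewrite addn_eq0 => /andP[/nilP p0 /eqP/IH ->].
have -> : p.2 = 1%g by apply: val_inj.
by rewrite !mulg1 mulgV.
Qed.

End Bounds.

(** * From linear to polynomial bounds *)

Local Open Scope ring_scope.

Theorem proposition6p8 (X : finType) (R : set (freeGroup X))
    (Rinv : forall r, R r -> R (r^-1)%g) (n : nat) :
  (* The upper bounds fail when n > 0 and the only relator of length at most n
     is the empty word: the right-hand sides are then negative. *)
  let nondegenerate := n = 0%N \/
    (exists w, [/\ relator R w, w <> 1%g & (size w <= n)%N]) in
  let D : rat := (Delta R n)%:R in
  let G : rat := (Omega_g R n)%:R in
  let L : rat := (DL (mrel R) n 0)%:R in
  let W : rat := (Omega (mrel R) n 0)%:R in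
  (G <= W /\
   (nondegenerate -> W <= 4 * G ^+ 3 + G ^+ 2 + (4 * n%:R + 1) * G - n%:R)) /\
  (forall c : nat, (forall r, R r -> (size r <= c)%N) ->
    (D <= L /\
     (nondegenerate ->
      L <= 2 * c%:R * D ^+ 2 + (2 * n%:R + c%:R / 2 + 1) * D - n%:R / 2)) /\
    (G <= W /\
     (nondegenerate ->
      W <= 4 * c%:R * G ^+ 2 + (4 * n%:R + c%:R + 1) * G - n%:R))).
Proof.
move=> nondegenerate D G L W.
(* This absorbs the two copies of [n]: the one in the linear bound and the one subtracted on the
   right. *)
have nG : nondegenerate -> (n <= n * Omega_g R n)%N.
  by case=> [->|[w [Rw w1 wn]]] //; apply/leq_pmulr/(Omega_g_gt0 Rinv Rw w1 wn).
have W_le := Omega_le Rinv n.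
have GW : G <= W by rewrite ler_nat; exact: Omega_g_le_Omega.
rewrite {}/D {}/G {}/L {}/W in GW *; clearbody nondegenerate.
have powS (k m : nat) : (m <= m ^ k.+1)%N.
  by case: m => // m; rewrite expnS leq_pmulr // expn_gt0.
split.
  split=> // /nG {}nG.
  suff : (Omega (mrel R) n 0 + n <= 4 * Omega_g R n ^ 3 + Omega_g R n ^ 2
      + (4 * n + 1) * Omega_g R n)%N.
    by rewrite -(ler_nat rat) !(natrX, natrM, natrD); lra.
  by have := powS 2 (Omega_g R n); lia.
move=> c Rc; have DG := Omega_g_le_Delta Rinv n Rc.
split; split=> //; first by rewrite ler_nat; exact: Delta_le_DL.
  move=> /nG {}nG; have L_le := DL_le Rinv n Rc.
  (* For [n > 0] the group work is positive, and it is at most [c] times the Dehn function, so the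
     latter is positive too. *)
  have nD : (n <= n * Delta R n)%N.
    case: (posnP n) => [->//|n_gt0]; apply: leq_pmulr.
    have : (0 < c * Delta R n)%N.
      by apply: leq_trans DG; rewrite -(ltn_pmul2l n_gt0) muln0 (leq_trans n_gt0).
    by rewrite muln_gt0 => /andP[].
  suff : (2 * DL (mrel R) n 0 + n <= 4 * c * Delta R n ^ 2
      + (4 * n + c + 2) * Delta R n)%N.
    by rewrite -(ler_nat rat) !(natrX, natrM, natrD); lra.
  by have := leq_mul (leqnn c) (powS 1 (Delta R n)); lia.
move=> /nG {}nG.
suff : (Omega (mrel R) n 0 + n <= 4 * c * Omega_g R n ^ 2
    + (4 * n + c + 1) * Omega_g R n)%N.
  by rewrite -(ler_nat rat) !(natrX, natrM, natrD); lra.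
(* If [c = 0], the group work vanishes, and then so do [n] and the derivational work. *)
have [c0|c_gt0] := posnP c.
  by move: DG; rewrite c0 mul0n leqn0 => /eqP G0; rewrite G0 in nG W_le *; lia.
have := leq_mul c_gt0 (powS 1 (Omega_g R n)); lia.
Qed.
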